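(* The space $B_\infty$ of all ropes is contractible.
   Context: Let $A=(0,0,0)$ and $B=(1,0,0)$ in $\mathbb{R}^3$. A rope is a non-singular $C^1$-smooth embedding $r:[0,1]\to\mathbb{R}^3$ with $r(0)=A$ and $r(1)=B$ (non-singularity includes the condition that the tangent vectors $\frac{dr}{dt}(0)$ and $\frac{dr}{dt}(1)$ are non-zero). The space of all ropes with the $C^1$-topology is denoted $B_\infty$. *)

(* Defs.v *)
From HB Require Import structures.
From mathcomp Require Import all_boot all_order all_algebra.
From mathcomp Require Import all_classical all_reals all_analysis.
Set Implicit Arguments.
Unset Strict Implicit.
Unset Printing Implicit Defensive.
Import Order.TTheory GRing.Theory Num.Theory.
Import numFieldNormedType.Exports.
Local Open Scope classical_set_scope.
Local Open Scope ring_scope.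

(* [0, 1] as a topological space of its own, so that limits and continuity on
   it are one-sided at the endpoints. *)
Definition unit_itv (R : realType) : set R := `[0, 1].
Arguments unit_itv : clear implicits.

Lemma unit_itv0 (R : realType) : (0 : R) \in unit_itv R.
Proof. by apply: mem_set; rewrite /unit_itv /= in_itv /= lexx ler01. Qed.

Lemma unit_itv1 (R : realType) : (1 : R) \in unit_itv R.
Proof. by apply: mem_set; rewrite /unit_itv /= in_itv /= lexx ler01. Qed.

Definition itv0 (R : realType) : unit_itv R := exist _ 0 (@unit_itv0 R).
Definition itv1 (R : realType) : unit_itv R := exist _ 1 (@unit_itv1 R).
Arguments itv0 : clear implicits.
Arguments itv1 : clear implicits.

Definition homotopic (R : realType) (X Y : topologicalType) (f g : X -> Y) :=
  exists H : unit_itv R * X -> Y,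
    [/\ continuous H,
        forall x, H (itv0 R, x) = f x &
        forall x, H (itv1 R, x) = g x].

Definition contractible (R : realType) (X : topologicalType) :=
  exists x0 : X, homotopic R (fun x : X => x) (fun=> x0).

Definition topological_embedding (X Y : topologicalType) (f : X -> Y) :=
  [/\ continuous f,
      injective f &
      forall U : set X, open U -> exists2 V : set Y, open V & f @^-1` V = U].

Section Ropes.
Context {R : realType}.
Implicit Types (r : unit_itv R -> 'rV[R]_3) (t : unit_itv R).

Definition diff_quotient r t : unit_itv R -> 'rV[R]_3 :=
  fun s => (set_val s - set_val t)^-1 *: (r s - r t).

Definition velocity r t : 'rV[R]_3 := lim (diff_quotient r t s @[s --> t^']).

Definition C1_curve r :=
  (forall t, cvg (diff_quotient r t s @[s --> t^'])) /\
  continuous (velocity r).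

Definition pointA : 'rV[R]_3 := 0.
Definition pointB : 'rV[R]_3 := delta_mx 0 0.

Definition is_rope r :=
  [/\ C1_curve r,
      forall t, velocity r t != 0,
      topological_embedding r,
      r (itv0 R) = pointA &
      r (itv1 R) = pointB].

End Ropes.

Definition rope (R : realType) : Type :=
  {r : unit_itv R -> 'rV[R]_3 | is_rope r}.

HB.instance Definition _ (R : realType) := gen_eqMixin (rope R).
HB.instance Definition _ (R : realType) := gen_choiceMixin (rope R).

(* The C^1 topology: uniform convergence of a curve and of its velocity. *)
Definition rope_jet (R : realType) (r : rope R) :
    ({uniform unit_itv R -> 'rV[R]_3} * {uniform unit_itv R -> 'rV[R]_3})%type :=
  (sval r, velocity (sval r)).

HB.instance Definition _ (R : realType) :=
  Topological.copy (rope R) (initial_topology (@rope_jet R)).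

(* Main.v *)
Require Import Defs.
From mathcomp Require Import all_boot all_order all_algebra.
From mathcomp Require Import all_classical all_reals all_analysis.
From mathcomp Require Import ring lra.
Set Implicit Arguments.
Unset Strict Implicit.
Unset Printing Implicit Defensive.
Import Order.TTheory GRing.Theory Num.Theory.
Import numFieldNormedType.Exports.
Local Open Scope classical_set_scope.
Local Open Scope ring_scope.

(* A rope r is shrunk towards its initial point: for s in ]0, 1] the restriction
   of r to [0, s], rescaled by 1/s, is t |-> r(st)/s, and it extends to s = 0 by
   the segment t |-> t r'(0), continuously in the C^1 topology. Its endpoint
   w(s) = r(s)/s (w(0) = r'(0)) never vanishes, but it moves; it is brought back
   to B by an invertible linear map A(s) with A(1) = 1, so that the segment AB
   is reached at s = 0 whatever r is. To make A(s) depend continuously on r,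
   one lifts the path w step by step: with points 1 = p_0 > p_1 > ... going down
   to s, A(s) is a product of elementary maps sending w(p_{k+1}) to w(p_k),
   each invertible as soon as these vectors make an acute angle. A step size
   with this property is chosen as a continuous function of r, and the
   superfluous steps, for which p_{k+1} = p_k = s, contribute the identity. *)

(** * The unit interval: clamping, compactness, multiplication *)

Section UnitInterval.
Context {R : realType}.
Implicit Types (s t : unit_itv R) (x y : R).

Lemma unit_itv_bounds t : 0 <= set_val t <= 1.
Proof. by have := set_valP t; rewrite /unit_itv /= in_itv. Qed.

Lemma set_val_inj : injective (set_val : unit_itv R -> R).
Proof. by move=> s t; rewrite set_valE => /val_inj. Qed.

Fact clamp_subproof x : Num.min 1 (Num.max 0 x) \in unit_itv R.
Proof.
apply: mem_set; rewrite /unit_itv /= in_itv /= le_min ler01 le_max lexx /=.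
by rewrite ge_min lexx.
Qed.

(** A continuous retraction of the line onto the interval: points of [unit_itv R] can be given by
    real formulas, the bounds being checked only when the value is read off. *)
Definition clamp x : unit_itv R :=
  @exist _ (fun y => y \in unit_itv R) _ (clamp_subproof x).

Lemma set_val_clamp x : 0 <= x <= 1 -> set_val (clamp x) = x.
Proof. by move=> /andP[x0 x1]; rewrite set_valE /= max_r // min_r. Qed.

Lemma set_valK : cancel (set_val : unit_itv R -> R) clamp.
Proof.
by move=> t; apply: set_val_inj; rewrite set_val_clamp ?unit_itv_bounds.
Qed.

Lemma set_val0 : set_val (itv0 R) = 0. Proof. by rewrite set_valE. Qed.
Lemma set_val1 : set_val (itv1 R) = 1. Proof. by rewrite set_valE. Qed.

Lemma set_val_continuous : continuous (set_val : unit_itv R -> R).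
Proof. exact: initial_continuous. Qed.

Lemma clamp_continuous : continuous clamp.
Proof.
apply: continuous_comp_initial => x.
apply: (@continuous_min R R (fun=> 1) (fun x => Num.max 0 x)).
  exact: cvg_cst.
apply: (@continuous_max R R (fun=> 0) id); first exact: cvg_cst.
exact: cvg_id.
Qed.

Lemma unit_itv_compact : compact [set: unit_itv R].
Proof.
have -> : [set: unit_itv R] = clamp @` `[0, 1].
  apply/seteqP; split=> // t _; exists (set_val t); last exact: set_valK.
  by rewrite /= in_itv /= unit_itv_bounds.
apply: continuous_compact; last exact: segment_compact.
exact/continuous_subspaceT/clamp_continuous.
Qed.

(** The interval has no isolated point. This makes limits along [t^'] unique, so that a velocity is
    determined by its difference quotients. *)
Lemma unit_itv_dnbhs_proper t : ProperFilter t^'.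
Proof.
apply: Build_ProperFilter_ex => A /nbhs_ballP[e /= e0 tA].
have /andP[t0 t1] := unit_itv_bounds t.
have [d [d0 de d1]] : exists d, [/\ 0 < d, d < e & d <= 1 / 2].
  exists (Num.min e 1 / 2); split.
  - by rewrite divr_gt0 // lt_min e0 ltr01.
  - by rewrite ltr_pdivrMr // gt_min ltr_pMr // ltr1n.
  - by rewrite ler_pM2r ?invr_gt0 // ge_min lexx orbT.
(* Stepping away from the nearer endpoint by at most 1/2 never leaves the interval. *)
pose x := if set_val t <= 1 / 2 then set_val t + d else set_val t - d.
have x01 : 0 <= x <= 1.
  by rewrite /x; case: (lerP (set_val t)) => ?; apply/andP; split; lra.
have xt : `|set_val t - x| = d.
  rewrite /x; case: (lerP (set_val t)) => _.
    by rewrite opprD addNKr normrN gtr0_norm.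
  by rewrite subKr gtr0_norm.
exists (clamp x); apply: tA => /=.
  by change (`|set_val t - set_val (clamp x)| < e); rewrite set_val_clamp // xt.
apply/eqP => xE; move: xt; rewrite -xE set_val_clamp // subrr normr0 => d00.
by rewrite -d00 ltxx in d0.
Qed.

Definition mul_itv s t : unit_itv R := clamp (set_val s * set_val t).

Lemma set_val_mul s t : set_val (mul_itv s t) = set_val s * set_val t.
Proof.
have /andP[s0 s1] := unit_itv_bounds s; have /andP[t0 t1] := unit_itv_bounds t.
by rewrite set_val_clamp // mulr_ge0 //= mulr_ile1.
Qed.

Lemma mul_itv_continuous : continuous (fun p => mul_itv p.1 p.2).
Proof.
move=> p; apply: continuous_comp; last exact: clamp_continuous.
by apply: cvgM; (apply: continuous_comp; last exact: set_val_continuous);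
  [exact: cvg_fst|exact: cvg_snd].
Qed.

End UnitInterval.

(** * Velocities of curves and a mean value inequality *)

Section Velocity.
Context {R : realType}.
Implicit Types (r : unit_itv R -> 'rV[R]_3) (t : unit_itv R).

Definition has_velocity r t (v : 'rV[R]_3) :=
  diff_quotient r t s @[s --> t^'] --> v.

Lemma has_velocityE r t v : has_velocity r t v -> velocity r t = v.
Proof.
have := unit_itv_dnbhs_proper t => ? rv.
by apply: cvg_lim rv; exact: norm_hausdorff.
Qed.

Lemma C1_curve_has_velocity r t : C1_curve r -> has_velocity r t (velocity r t).
Proof. by move=> [+ _] => /(_ t). Qed.

(** True at [s = t] as well, since the quotient is then multiplied by 0. Letting [s] tend to [t]
    shows that a curve with a velocity is continuous. *)
Lemma diff_quotientK r t s :
  r t + (set_val s - set_val t) *: diff_quotient r t s = r s.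
Proof.
rewrite /diff_quotient; have [->|st] := eqVneq s t.
  by rewrite !subrr scaler0 scaler0 addr0.
rewrite scalerA mulfV ?scale1r; first by rewrite addrC subrK.
by rewrite subr_eq0; apply: contra_neq st => /set_val_inj.
Qed.

Lemma has_velocity_continuous r t v :
  has_velocity r t v -> {for t, continuous r}.
Proof.
move=> rv; apply/continuous_withinNx.
suff : r t + (set_val s - set_val t) *: diff_quotient r t s @[s --> t^'] --> r t.
  by rewrite (funext (diff_quotientK r t)).
rewrite -[X in _ --> X]addr0 -(scale0r v) -(subrr (set_val t)).
apply: cvgD; first exact: cvg_cst.
apply: cvgZ => //; apply: cvgB; last exact: cvg_cst.
by apply/continuous_withinNx/set_val_continuous.
Qed.

Lemma injective_embedding r :
  continuous r -> injective r -> topological_embedding r.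
Proof.
move=> rc rinj; split=> // U oU; exists (~` (r @` ~` U)).
  apply: closed_openC; apply: compact_closed; first exact: norm_hausdorff.
  apply: continuous_compact; first exact: continuous_subspaceT.
  by apply: (subclosed_compact _ unit_itv_compact) => //; exact: open_closedC.
apply/seteqP; split=> t /=; first by apply: contra_notP => nUt; exists t.
by move=> Ut [s nUs /rinj st]; rewrite st in nUs.
Qed.

Lemma is_rope_intro r v :
  (forall t, has_velocity r t (v t)) -> continuous v -> (forall t, v t != 0) ->
  injective r -> r (itv0 R) = pointA -> r (itv1 R) = pointB -> is_rope r.
Proof.
move=> rv cv v0 rinj rA rB.
have vE : velocity r = v by apply/funext => t; exact: has_velocityE.
split=> //.
- by split=> [t|]; rewrite ?vE //; apply/cvg_ex; exists (v t); exact: rv.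
- by move=> t; rewrite vE.
- by apply: injective_embedding => // t; exact: has_velocity_continuous (rv t).
Qed.

Lemma has_velocity_line (c : 'rV[R]_3) t :
  has_velocity (fun s => set_val s *: c) t c.
Proof.
apply: (@cvg_trans _ (cst c s @[s --> t^'])); last exact: cvg_cst.
apply: near_eq_cvg.
near=> s; have st : s != t by near: s; exact: nbhs_dnbhs_neq.
rewrite /diff_quotient -scalerBl scalerA mulVf ?scale1r //.
by rewrite subr_eq0; apply: contra_neq st => /set_val_inj.
Unshelve. all: by end_near. Qed.

Lemma has_velocityB r1 r2 t v1 v2 : has_velocity r1 t v1 ->
  has_velocity r2 t v2 -> has_velocity (fun s => r1 s - r2 s) t (v1 - v2).
Proof.
move=> h1 h2; rewrite /has_velocity.
have -> : diff_quotient (fun s => r1 s - r2 s) t =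
   diff_quotient r1 t \- diff_quotient r2 t.
  apply/funext => s; rewrite /diff_quotient /= -scalerBr; congr (_ *: _).
  by rewrite !opprD !opprK addrACA.
exact: cvgB.
Qed.

(** The factor 1/s turns the quotient of the new curve into that of [r] at [mul_itv s t],
    precomposed with multiplication by s. The latter is injective, hence respects punctured
    neighbourhoods. *)
Lemma has_velocity_rescale r (s t : unit_itv R) v : set_val s != 0 ->
  has_velocity r (mul_itv s t) v ->
  has_velocity (fun u => (set_val s)^-1 *: r (mul_itv s u)) t v.
Proof.
move=> s0 rv; rewrite /has_velocity.
have -> : diff_quotient (fun u => (set_val s)^-1 *: r (mul_itv s u)) t =
    diff_quotient r (mul_itv s t) \o mul_itv s.
  apply/funext => u; rewrite /diff_quotient /= -scalerBr scalerA; congr (_ *: _).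
  by rewrite !set_val_mul -mulrBr invfM mulrC.
apply: (cvg_comp (mul_itv s) (diff_quotient r (mul_itv s t)) _ rv).
apply: (@continuous_injective_withinNx _ _ (mul_itv s)) => [|u].
  apply: (continuous_comp (f := fun u => set_val s * set_val u)).
    by apply: continuousM; [exact: cst_continuous|exact: set_val_continuous].
  exact: clamp_continuous.
move=> /(congr1 set_val); rewrite !set_val_mul => /(mulfI s0).
exact: set_val_inj.
Qed.

(** The norm of a row vector is the largest absolute value of its entries, so the scalar mean value
    theorem, applied to each coordinate, loses no constant. *)
Lemma mean_value_bound r v (C : R) :
  (forall t, has_velocity r t (v t)) -> (forall t, `|v t| <= C) ->
  r (itv0 R) = 0 -> forall t, `|r t| <= C.
Proof.
move=> rv vC r0 t.
have C0 : 0 <= C := le_trans (normr_ge0 _) (vC t).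
have rc : continuous r by move=> s; exact: has_velocity_continuous (rv s).
rewrite /Num.norm /= mx_normrE; apply/bigmax_leP; split=> // -[i j] _ /=.
rewrite (ord1 i) {i}.
have /andP[t0 t1] := unit_itv_bounds t.
have [tz|tn0] := eqVneq (set_val t) 0.
  have -> : t = itv0 R by apply: set_val_inj; rewrite tz set_val0.
  by rewrite r0 mxE normr0.
have tpos : 0 < set_val t by rewrite lt_neqAle eq_sym tn0.
(* [clamp] extends the coordinate to the whole line, where the mean value theorem is stated; a
   derivative is claimed only inside the interval. *)
pose g (x : R) : R := r (clamp x) 0 j.
have gc : continuous g.
  move=> x; apply: (continuous_comp (g := fun M : 'rV[R]_3 => M 0 j)).
    by apply: continuous_comp; [exact: clamp_continuous|exact: rc].
  exact: coord_continuous.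
have gd x : x \in `]0, (set_val t)[ -> is_derive x 1 g (v (clamp x) 0 j).
  rewrite in_itv /= => /andP[x0 xt].
  have x1 : x < 1 := lt_le_trans xt t1.
  have cx : set_val (clamp x) = x by rewrite set_val_clamp // !ltW.
  have gdx : h^-1 *: (g (h + x) - g x) @[h --> 0^'] --> v (clamp x) 0 j.
    pose q s := diff_quotient r (clamp x) s 0 j.
    have qc : q s @[s --> (clamp x)^'] --> v (clamp x) 0 j.
      apply: (cvg_comp _ (fun M : 'rV[R]_3 => M 0 j) (rv (clamp x))).
      exact: coord_continuous.
    have small : \forall h \near (0 : R)^', 0 <= h + x <= 1.
      near=> h; have : `|h| < Num.min x (1 - x).
        by near: h; apply: dnbhs0_lt; rewrite lt_min x0 subr_gt0.
      by rewrite lt_min !ltr_norml => /andP[/andP[? _] /andP[_ ?]];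
        apply/andP; split; lra.
    have shiftc : h + x @[h --> 0] --> x.
      rewrite -[X in _ --> X]add0r.
      by apply: cvgD; [exact: cvg_id|exact: cvg_cst].
    (* For small h the point h + x stays in [0, 1], where [clamp] is injective, so the punctured
       neighbourhoods correspond. *)
    have cl : clamp (h + x) @[h --> 0^'] --> (clamp x)^'.
      move=> A xA; have := cvg_comp _ _ shiftc (@clamp_continuous R x) _ xA.
      move=> hA; suff : \forall h \near (0 : R)^', A (clamp (h + x)) by [].
      near=> h; have hA' : clamp (h + x) != clamp x -> A (clamp (h + x)).
        by near: h; apply: nbhs_dnbhs; exact: hA.
      have h0 : h != 0 by near: h; exact: nbhs_dnbhs_neq.
      have hx : 0 <= h + x <= 1 by near: h; exact: small.
      apply: hA'; apply: contra_neq h0 => /(congr1 set_val).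
      by rewrite cx set_val_clamp // => /eqP; rewrite -subr_eq0 addrK => /eqP.
    apply: cvg_trans (cvg_comp _ _ cl qc); apply: near_eq_cvg.
    near=> h; rewrite /q /= /diff_quotient !mxE cx set_val_clamp ?addrK //.
    by near: h; exact: small.
  have shE : (fun h : R => h^-1 *: ((g \o shift x) h%:A - g x)) =
             (fun h => h^-1 *: (g (h + x) - g x)).
    by apply/funext => h; rewrite /= [_%:A]mulr1.
  split; first by rewrite /derivable shE; apply/cvg_ex; exists (v (clamp x) 0 j).
  by rewrite /derive shE; apply: cvg_lim gdx.
have [c _ gtc] := MVT tpos gd (continuous_subspaceT gc).
have -> : r t 0 j = g (set_val t) - g 0.
  rewrite /g set_valK -set_val0 set_valK r0 mxE subr0 //.
rewrite gtc subr0 normrM (ger0_norm t0).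
apply: le_trans (vC (clamp c)); apply: le_trans (_ : `|v (clamp c) 0 j| <= _).
  by rewrite ler_piMr.
rewrite {2}/Num.norm /= mx_normrE.
exact: (le_bigmax _ (fun ij : 'I_1 * 'I_3 => `|v (clamp c) ij.1 ij.2|) (0, j)).
Unshelve. all: by end_near. Qed.

End Velocity.

(** * Elementary linear maps carrying one vector to another *)

Section Shear.
Context {R : realType} {n : nat}.
Implicit Types u v x : 'rV[R]_n.

Definition dot u v : R := (u *m v^T) 0 0.

Lemma dotE u v : dot u v = \sum_j u 0 j * v 0 j.
Proof. by rewrite /dot mxE; apply: eq_bigr => j _; rewrite mxE. Qed.

Lemma dotC u v : dot u v = dot v u.
Proof. by rewrite !dotE; apply: eq_bigr => j _; rewrite mulrC. Qed.

Lemma dotDl u v x : dot (u + v) x = dot u x + dot v x.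
Proof. by rewrite /dot mulmxDl mxE. Qed.

Lemma dotBl u v x : dot (u - v) x = dot u x - dot v x.
Proof. by rewrite /dot mulmxBl !mxE. Qed.

Lemma dotZl (a : R) u x : dot (a *: u) x = a * dot u x.
Proof. by rewrite /dot -scalemxAl mxE. Qed.

Lemma dot_gt0 u : u != 0 -> 0 < dot u u.
Proof.
move=> u0; rewrite dotE lt0r sumr_ge0 ?andbT => [|j _]; last exact: sqr_ge0.
apply: contra_neq u0 => /eqP; rewrite psumr_eq0 => [/allP uz|j _];
  last exact: sqr_ge0.
apply/rowP => j; rewrite mxE; apply/eqP.
by have := uz j (mem_index_enum j); rewrite mulf_eq0 orbb.
Qed.

(* The linear map fixing the orthogonal complement of [u] and sending [u] to
   [v]; unlike a rotation it needs neither normalization nor square roots. *)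
Definition shear u v : 'M[R]_n := 1%:M + (dot u u)^-1 *: (u^T *m (v - u)).

Lemma mul_shear x u v : x *m shear u v = x + (dot x u / dot u u) *: (v - u).
Proof.
rewrite /shear mulmxDr mulmx1 -scalemxAr mulmxA; congr (_ + _).
by rewrite [x *m u^T]mx11_scalar mul_scalar_mx scalerA mulrC.
Qed.

Lemma shearxx u : shear u u = 1%:M.
Proof. by rewrite /shear subrr mulmx0 scaler0 addr0. Qed.

Lemma shear_apply u v : u != 0 -> u *m shear u v = v.
Proof.
by move=> /dot_gt0 u0; rewrite mul_shear divff ?gt_eqF // scale1r addrC subrK.
Qed.

(** The image of x has inner product [dot x u * dot v u / dot u u] with u. If the image is zero,
    then x is orthogonal to u, hence fixed by the shear, hence zero. *)
Lemma shear_inj u v x : u != 0 -> 0 < dot u v -> x *m shear u v = 0 -> x = 0.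
Proof.
move=> /dot_gt0 u0 uv; rewrite mul_shear => xz.
have xE : (dot x u / dot u u) * dot v u = 0.
  have := congr1 (dot^~ u) xz; rewrite /= dotDl dotZl dotBl mulrBr.
  by rewrite divfK ?gt_eqF // addrCA subrr addr0 => ->; rewrite /dot mul0mx mxE.
have /eqP := xE; rewrite mulf_eq0 [dot v u]dotC (gt_eqF uv) orbF => /eqP c0.
by rewrite c0 scale0r addr0 in xz.
Qed.

End Shear.

(** * Limits of matrix expressions *)

Section MatrixLimits.
Context {R : realType} {T : Type} {F : set_system T} {FF : Filter F}.

Lemma cvg_mx m n (f : T -> 'M[R]_(m, n)) (A : 'M[R]_(m, n)) :
  (forall i j, f x i j @[x --> F] --> A i j) -> f @ F --> A.
Proof.
move=> fA B [P AP PB]; apply: filterS (PB) _ => /=.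
by apply: filter_forall => i; apply: filter_forall => j; exact: fA (AP i j).
Qed.

Lemma cvg_coord m n (f : T -> 'M[R]_(m, n)) (A : 'M[R]_(m, n)) i j :
  f @ F --> A -> f x i j @[x --> F] --> A i j.
Proof.
move=> fA; apply: (cvg_comp _ (fun M : 'M[R]_(m, n) => M i j) fA).
exact: coord_continuous.
Qed.

Lemma cvg_mulmx m n p (f : T -> 'M[R]_(m, n)) (g : T -> 'M[R]_(n, p))
    (A : 'M[R]_(m, n)) (B : 'M[R]_(n, p)) :
  f @ F --> A -> g @ F --> B -> f x *m g x @[x --> F] --> A *m B.
Proof.
move=> fA gB; apply: cvg_mx => i j; rewrite mxE.
under eq_fun do rewrite mxE.
apply: cvg_big => [|k _]; first exact: add_continuous.
by apply: cvgM; exact: cvg_coord.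
Qed.

Lemma cvg_trmx m n (f : T -> 'M[R]_(m, n)) (A : 'M[R]_(m, n)) :
  f @ F --> A -> (f x)^T @[x --> F] --> A^T.
Proof.
move=> fA; apply: cvg_mx => i j; rewrite mxE.
by under eq_fun do rewrite mxE; exact: cvg_coord.
Qed.

Lemma cvg_dot n (f g : T -> 'rV[R]_n) (u v : 'rV[R]_n) :
  f @ F --> u -> g @ F --> v -> dot (f x) (g x) @[x --> F] --> dot u v.
Proof.
by move=> fu gv; apply: cvg_coord; apply: cvg_mulmx => //; exact: cvg_trmx.
Qed.

Lemma cvg_shear n (f g : T -> 'rV[R]_n) (u v : 'rV[R]_n) : u != 0 ->
  f @ F --> u -> g @ F --> v -> shear (f x) (g x) @[x --> F] --> shear u v.
Proof.
move=> u0 fu gv; apply: cvgD; first exact: cvg_cst.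
apply: cvgZ; first by apply: cvgV; [rewrite gt_eqF ?dot_gt0|exact: cvg_dot].
by apply: cvg_mulmx; [exact: cvg_trmx|exact: cvgB].
Qed.

End MatrixLimits.

(** A form of the tube lemma: compactness of K makes joint continuity uniform in k. It yields the
    continuity of the chord, of the mesh and of the final homotopy. *)
Lemma near_uniform (R : realType) (X K : topologicalType) (V : normedModType R)
    (f : X * K -> V) (x : X) (e : R) :
  compact [set: K] -> continuous f -> 0 < e ->
  \forall y \near x, forall k, `|f (x, k) - f (y, k)| < e.
Proof.
move=> /compact_near_coveringP cK cf e0.
suff : \forall y \near x, [set: K] `<=` (fun k => `|f (x, k) - f (y, k)| < e).
  by apply: filterS => y h k; exact: h.
apply: cK => k _.
have e20 : 0 < e / 2 by rewrite divr_gt0.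
have [[A B] /= [xA kB] AB] := (iffLR (cvgrPdist_lt _ _)) (cf (x, k)) _ e20.
exists (B, A); first by split.
(* Both (x, k') and (y, k') have values within e / 2 of the value at (x, k). *)
move=> [k' y] /= [Bk' Ay].
have h1 := AB (x, k') (conj (nbhs_singleton xA) Bk').
have h2 := AB (y, k') (conj Ay Bk').
rewrite /= in h1 h2 *.
rewrite -(subrKA (f (x, k))) (le_lt_trans (ler_normD _ _)) //.
by rewrite [e]splitr ltrD // distrC.
Qed.

(** * The topology of the space of ropes, and rescaled ropes *)

Section RopeSpace.
Context {R : realType}.
Implicit Types (r : rope R) (s t : unit_itv R).

Definition rope_velocity r := velocity (sval r).

Lemma rope_has_velocity r t : has_velocity (sval r) t (rope_velocity r t).
Proof. by have [C1 _ _ _ _] := svalP r; exact: C1_curve_has_velocity. Qed.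

Lemma rope_velocity_near r (e : R) : 0 < e ->
  \forall r' \near r, forall t, `|rope_velocity r t - rope_velocity r' t| < e.
Proof.
move=> e0.
have jc : {for r, continuous (@rope_jet R)} by exact: initial_continuous.
have : \forall j \near rope_jet r, forall t, `|(rope_jet r).2 t - j.2 t| < e.
  have : \forall g \near (rope_jet r).2, forall t, `|(rope_jet r).2 t - g t| < e.
    apply/uniform_nbhs.
    exists [set xy | ball xy.1 (PosNum e0)%:num xy.2].
    split; first exact: entourage_ball.
    move=> g /= h t; have := h t I; rewrite mx_norm_ball //.
  exact: cvg_snd.
exact: jc.
Qed.

Lemma rope_velocity_continuous :
  continuous (fun p : rope R * unit_itv R => rope_velocity p.1 p.2).
Proof.
move=> [r t]; apply/cvgrPdist_lt => e e0 /=.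
have e20 : 0 < e / 2 by rewrite divr_gt0.
have [[_ cv] _ _ _ _] := svalP r.
have h1 : \forall p \near (r, t), forall u,
    `|rope_velocity r u - rope_velocity p.1 u| < e / 2.
  exact: (cvg_fst (rope_velocity_near r e20)).
have h2 : \forall p \near (r, t),
    `|rope_velocity r t - rope_velocity r p.2| < e / 2.
  exact: (cvg_snd ((iffLR (cvgrPdist_lt _ _)) (cv t) _ e20)).
apply: filterS2 h1 h2 => -[r' t'] /= h1 h2.
rewrite -(subrKA (rope_velocity r t')) (le_lt_trans (ler_normD _ _)) //.
by rewrite [e]splitr ltrD.
Qed.

Lemma rope_diff_bound r r' (e : R) :
  (forall t, `|rope_velocity r t - rope_velocity r' t| <= e) ->
  forall t, `|sval r t - sval r' t| <= e.
Proof.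
move=> vC; apply: (@mean_value_bound _ (fun t => sval r t - sval r' t)
  (fun t => rope_velocity r t - rope_velocity r' t)) => // [t|].
  by apply: has_velocityB; exact: rope_has_velocity.
have [_ _ _ rA _] := svalP r; have [_ _ _ r'A _] := svalP r'.
by rewrite rA r'A subrr.
Qed.

(* Since all ropes start at [A], closeness of the velocities already controls
   the curves themselves. *)
Lemma continuous_rope (X : topologicalType) (H : X -> rope R) :
  (forall x e, 0 < e -> \forall y \near x, forall t,
    `|rope_velocity (H x) t - rope_velocity (H y) t| < e) ->
  continuous H.
Proof.
move=> Hv; apply: continuous_comp_initial => x.
have unif (g : X -> {uniform unit_itv R -> 'rV[R]_3}) :
    (forall e, 0 < e -> \forall y \near x, forall t, `|g x t - g y t| <= e) ->
    g y @[y --> x] --> g x.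
  move=> gx U /uniform_nbhs[E [entE EU]].
  have [e /= e0 eE] : exists2 e : R, 0 < e &
      forall u v : 'rV[R]_3, `|u - v| < e -> E (u, v).
    move: entE; rewrite -entourage_ballE => -[e /= e0 eE]; exists e => // u v uv.
    by apply: eE; rewrite /= mx_norm_ball.
  have e20 : 0 < e / 2 by rewrite divr_gt0.
  apply: filterS (gx _ e20) => y gxy; apply: EU => t _; apply: eE.
  by rewrite (le_lt_trans (gxy t)) // ltr_pdivrMr // ltr_pMr // ltr1n.
have h1 : sval (H y) @[y --> x] --> (sval (H x) : {uniform unit_itv R -> 'rV[R]_3}).
  apply: unif => e e0; apply: filterS (Hv x e e0) => y xy.
  by apply: rope_diff_bound => t; exact: ltW.
have h2 : rope_velocity (H y) @[y --> x] -->
    (rope_velocity (H x) : {uniform unit_itv R -> 'rV[R]_3}).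
  by apply: unif => e e0; apply: filterS (Hv x e e0) => y xy t; exact: ltW.
exact: (cvg_pair h1 h2).
Qed.

(* [scaled r s] is the restriction of [r] to [0, s] rescaled by [1 / s],
   which at [s = 0] degenerates to the tangent segment of [r] at [A]. *)
Definition scaled r s t : 'rV[R]_3 :=
  if set_val s == 0 then set_val t *: rope_velocity r (itv0 R)
  else (set_val s)^-1 *: sval r (mul_itv s t).

(** The velocity obeys a single formula, jointly continuous in r, s and t, even though the curve is
    defined by cases. Continuity at s = 0 thus needs no separate argument. *)
Lemma has_velocity_scaled r s t :
  has_velocity (scaled r s) t (rope_velocity r (mul_itv s t)).
Proof.
rewrite /scaled /=; have [s0|s0] := eqVneq (set_val s) 0.
  have -> : mul_itv s t = itv0 R.
    by apply: set_val_inj; rewrite set_val_mul s0 mul0r set_val0.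
  exact: has_velocity_line.
by apply: has_velocity_rescale => //; exact: rope_has_velocity.
Qed.

Lemma scaled0 r s : scaled r s (itv0 R) = 0.
Proof.
rewrite /scaled set_val0 scale0r; case: ifPn => // _.
have [_ _ _ + _] := svalP r => /= rA.
have -> : mul_itv s (itv0 R) = itv0 R.
  by apply: set_val_inj; rewrite set_val_mul set_val0 mulr0.
by rewrite rA scaler0.
Qed.

Lemma scaled_inj r s : injective (scaled r s).
Proof.
move=> t u; rewrite /scaled; have [_|s0] := eqVneq (set_val s) 0.
  move=> /eqP; rewrite -subr_eq0 -scalerBl scaler_eq0.
  have [_ /(_ (itv0 R)) + _ _ _] := svalP r => /negPf ->.
  by rewrite orbF subr_eq0 => /eqP /set_val_inj.
move=> /(scalerI (invr_neq0 s0)); have [_ _ [_ rinj _] _ _] := svalP r.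
move=> /rinj /(congr1 set_val); rewrite !set_val_mul => /(mulfI s0).
exact: set_val_inj.
Qed.

Lemma scaled1 r t : scaled r (itv1 R) t = sval r t.
Proof.
rewrite /scaled set_val1 oner_eq0 invr1 scale1r; congr (sval r _).
by apply: set_val_inj; rewrite set_val_mul set_val1 mul1r.
Qed.

(** The vector w(s) of the opening comment. *)
Definition chord r s := scaled r s (itv1 R).

Lemma chord1 r : chord r (itv1 R) = pointB.
Proof. by rewrite /chord scaled1; have [_ _ _ _] := svalP r. Qed.

Lemma chord_neq0 r s : chord r s != 0.
Proof.
rewrite -(scaled0 r s); apply/eqP => /scaled_inj /(congr1 set_val).
by rewrite set_val0 set_val1 => /eqP; rewrite oner_eq0.
Qed.

Lemma scaled_velocity_continuous : continuous
  (fun p : (unit_itv R * rope R) * unit_itv R =>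
     rope_velocity p.1.2 (mul_itv p.1.1 p.2)).
Proof.
move=> p.
have c1 : q.1 @[q --> p] --> p.1 by exact: cvg_fst.
have cs : q.1.1 @[q --> p] --> p.1.1 by apply: (cvg_comp _ _ c1); exact: cvg_fst.
have cr : q.1.2 @[q --> p] --> p.1.2 by apply: (cvg_comp _ _ c1); exact: cvg_snd.
have ct : q.2 @[q --> p] --> p.2 by exact: cvg_snd.
have cm : mul_itv q.1.1 q.2 @[q --> p] --> mul_itv p.1.1 p.2.
  exact: (cvg_comp2 (h := @mul_itv R) cs ct (@mul_itv_continuous R (_, _))).
exact: (cvg_comp2 (h := rope_velocity) cr cm (@rope_velocity_continuous (_, _))).
Qed.

(** Two rescaled ropes both start at 0, so uniformly close velocities force close endpoints; the
    quotient r(s)/s is never studied near s = 0. *)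
Lemma chord_continuous :
  continuous (fun q : unit_itv R * rope R => chord q.2 q.1).
Proof.
move=> q; apply/cvgrPdist_le => e e0.
have := near_uniform q unit_itv_compact scaled_velocity_continuous e0.
apply: filterS => q' qq' /=; rewrite /chord.
apply: (@mean_value_bound _ (fun t => scaled q.2 q.1 t - scaled q'.2 q'.1 t)
  (fun t => rope_velocity q.2 (mul_itv q.1 t)
          - rope_velocity q'.2 (mul_itv q'.1 t))) => [t|t|].
- by apply: has_velocityB; exact: has_velocity_scaled.
- exact: ltW (qq' t).
- by rewrite !scaled0 subrr.
Qed.

End RopeSpace.

(** * A continuous choice of step size, and the transport matrix *)

Section Mesh.
Context {R : realType}.
Implicit Types (r : rope R) (s t : unit_itv R).

Lemma cvg_chord {T : Type} {F : set_system T} {FF : Filter F}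
    (a : T -> unit_itv R) (p : T -> rope R) s r :
  a @ F --> s -> p @ F --> r -> chord (p x) (a x) @[x --> F] --> chord r s.
Proof.
move=> cs cr.
exact: (cvg_comp2 (h := fun s r => chord r s) cs cr (@chord_continuous R (s, r))).
Qed.

(** Positive everywhere: the inner product is positive on the diagonal, the distance off it. Where
    the distance is below the minimum of this function, the inner product must be at least that
    minimum. *)
Definition obstruction r (ab : unit_itv R * unit_itv R) : R :=
  Num.max (dot (chord r ab.1) (chord r ab.2)) `|set_val ab.1 - set_val ab.2|.

Lemma obstruction_continuous :
  continuous (fun p : rope R * (unit_itv R * unit_itv R) => obstruction p.1 p.2).
Proof.
move=> p.
have cr : q.1 @[q --> p] --> p.1 by exact: cvg_fst.
have c2 : q.2 @[q --> p] --> p.2 by exact: cvg_snd.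
have ca : q.2.1 @[q --> p] --> p.2.1 by apply: (cvg_comp _ _ c2); exact: cvg_fst.
have cb : q.2.2 @[q --> p] --> p.2.2 by apply: (cvg_comp _ _ c2); exact: cvg_snd.
apply: (@continuous_max R _
  (fun p : rope R * (unit_itv R * unit_itv R) =>
     dot (chord p.1 p.2.1) (chord p.1 p.2.2))
  (fun p : rope R * (unit_itv R * unit_itv R) =>
     `|set_val p.2.1 - set_val p.2.2|)).
  by apply: cvg_dot; exact: cvg_chord.
apply: cvg_norm; apply: cvgB.
  by apply: (cvg_comp _ _ ca); exact: set_val_continuous.
by apply: (cvg_comp _ _ cb); exact: set_val_continuous.
Qed.

Lemma unit_square_compact : compact [set: unit_itv R * unit_itv R].
Proof. by rewrite -setXTT; apply: compact_setX; exact: unit_itv_compact. Qed.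

Lemma mesh_exists r :
  exists m, (exists ab, m = obstruction r ab) /\ forall ab, m <= obstruction r ab.
Proof.
have [||c _ cmin] := @compact_EVT_min _ R (obstruction r) _ _ unit_square_compact.
- by exists (itv0 R, itv0 R).
- apply: continuous_subspaceT => ab.
  have c2 : ((r, x) : rope R * (unit_itv R * unit_itv R)) @[x --> ab] --> (r, ab).
    exact: (cvg_pair (cvg_cst r) cvg_id).
  exact: (cvg_comp _ _ c2 (@obstruction_continuous (r, ab))).
- exists (obstruction r c); split; first by exists c.
  by move=> ab; apply: cmin; rewrite inE.
Qed.

(* The minimum of [obstruction r]. Any [d > 0] such that chords with parameters
   less than [d] apart make an acute angle would serve for a single rope; a
   minimum over a compact set moreover depends continuously on [r]. *)
Definition mesh r : R := projT1 (cid (mesh_exists r)).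

Lemma mesh_le r ab : mesh r <= obstruction r ab.
Proof. by rewrite /mesh; case: cid => m [? ?] /=. Qed.

Lemma mesh_attained r : exists ab, mesh r = obstruction r ab.
Proof. by rewrite /mesh; case: cid => m [? ?] /=. Qed.

Lemma mesh_gt0 r : 0 < mesh r.
Proof.
have [[a b] ->] := mesh_attained r; rewrite /obstruction /= lt_max.
have [->|ab] := eqVneq a b; first by rewrite dot_gt0 ?chord_neq0.
by rewrite orbC normr_gt0 subr_eq0 (contra_neq _ ab) // => /set_val_inj.
Qed.

Lemma mesh_acute r s t : `|set_val s - set_val t| < mesh r ->
  0 < dot (chord r s) (chord r t).
Proof.
move=> st; have := mesh_le r (s, t); rewrite /obstruction /= le_max.
by case/orP=> [|/(lt_le_trans st)]; [exact: lt_le_trans (mesh_gt0 r)|rewrite ltxx].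
Qed.

(** If two functions differ by less than e everywhere, so do their minima: each minimum is compared
    with the value of that function at the minimizer of the other. *)
Lemma mesh_continuous : continuous mesh.
Proof.
move=> r; apply/(cvgrPdist_lt (FF := nbhs_filter r)) => e e0.
have := near_uniform r unit_square_compact obstruction_continuous e0.
apply: (@filterS _ _ (nbhs_filter r)) => r' /= rr'.
have [ab mab] := mesh_attained r; have [cd mcd] := mesh_attained r'.
have := mesh_le r cd; have := mesh_le r' ab.
have := rr' ab; have := rr' cd; rewrite mab mcd !ltr_norml.
by move=> /andP[? ?] /andP[? ?] ? ?; apply/andP; split; lra.
Qed.

(** The point p_n of the opening comment. Steps of half the mesh are strictly shorter than it, and
    the maximum stops the descent at s. *)
Definition knot n r s : unit_itv R :=
  clamp (Num.max (1 - n%:R * (mesh r / 2)) (set_val s)).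

Lemma set_val_knot n r s :
  set_val (knot n r s) = Num.max (1 - n%:R * (mesh r / 2)) (set_val s).
Proof.
have /andP[s0 s1] := unit_itv_bounds s.
rewrite set_val_clamp // le_max s0 orbT ge_max s1 andbT gerBl.
by rewrite mulr_ge0 // divr_ge0 // ltW ?mesh_gt0.
Qed.

Lemma knot0 r s : knot 0 r s = itv1 R.
Proof.
have /andP[_ s1] := unit_itv_bounds s.
by apply: set_val_inj; rewrite set_val_knot set_val1 mul0r subr0 max_l.
Qed.

Lemma knot_end n r s : 1 <= n%:R * (mesh r / 2) -> knot n r s = s.
Proof.
have /andP[s0 _] := unit_itv_bounds s.
move=> hn; apply: set_val_inj; rewrite set_val_knot max_r //.
by rewrite (le_trans _ s0) // subr_le0.
Qed.

Lemma knot1 n r : knot n r (itv1 R) = itv1 R.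
Proof.
apply: set_val_inj; rewrite set_val_knot set_val1 max_r //.
by rewrite gerBl mulr_ge0 // divr_ge0 // ltW ?mesh_gt0.
Qed.

Lemma knot_acute n r s :
  0 < dot (chord r (knot n.+1 r s)) (chord r (knot n r s)).
Proof.
apply: mesh_acute; rewrite !set_val_knot.
have m0 := mesh_gt0 r; set d := mesh r / 2; set v := set_val s.
have d0 : 0 < d by rewrite divr_gt0.
have dm : d < mesh r by rewrite ltr_pdivrMr // ltr_pMr // ltr1n.
have -> : 1 - n.+1%:R * d = 1 - n%:R * d - d by rewrite -natr1; ring.
set y := 1 - n%:R * d; apply: le_lt_trans dm.
rewrite ler_norml; apply/andP.
(* Truncating below at v does not lengthen a step, so consecutive knots are at most d apart. *)
by case: (lerP y v) => ?; case: (lerP (y - d) v) => ?; split; lra.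
Qed.

Lemma cvg_knot n (q : unit_itv R * rope R) :
  knot n x.2 x.1 @[x --> q] --> knot n q.2 q.1.
Proof.
apply: (@continuous_comp _ _ _ (fun x : unit_itv R * rope R =>
  Num.max (1 - n%:R * (mesh x.2 / 2)) (set_val x.1)) clamp); last first.
  exact: clamp_continuous.
apply: (@continuous_max R _
  (fun x : unit_itv R * rope R => 1 - n%:R * (mesh x.2 / 2))
  (fun x : unit_itv R * rope R => set_val x.1)).
  apply: cvgB; first exact: cvg_cst.
  apply: cvgM; first exact: cvg_cst.
  apply: cvgM; last exact: cvg_cst.
  have c2 : x.2 @[x --> q] --> q.2 by exact: cvg_snd.
  by apply: (cvg_comp _ _ c2); exact: mesh_continuous.
have c1 : x.1 @[x --> q] --> q.1 by exact: cvg_fst.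
by apply: (cvg_comp _ _ c1); exact: set_val_continuous.
Qed.

(** Row vectors are multiplied on the right, so the leftmost factor acts first: the chord at knot n
    climbs knot by knot to the chord at 1, which is B. *)
Fixpoint partial_transport n r s : 'M[R]_3 :=
  if n is m.+1 then
    shear (chord r (knot n r s)) (chord r (knot m r s)) *m partial_transport m r s
  else 1%:M.

Lemma partial_transport_chord n r s :
  chord r (knot n r s) *m partial_transport n r s = pointB.
Proof.
elim: n => [|n IHn]; first by rewrite knot0 chord1 mulmx1.
by rewrite [partial_transport _ _ _]/= mulmxA shear_apply ?chord_neq0.
Qed.

Lemma partial_transport_inj n r s (x : 'rV[R]_3) :
  x *m partial_transport n r s = 0 -> x = 0.
Proof.
elim: n x => [|n IHn] x; first by rewrite mulmx1.
rewrite [partial_transport _ _ _]/= mulmxA => /IHn.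
by apply: shear_inj; [exact: chord_neq0|exact: knot_acute].
Qed.

Lemma partial_transport1 n r : partial_transport n r (itv1 R) = 1%:M.
Proof. by elim: n => //= n ->; rewrite !knot1 shearxx mulmx1. Qed.

(** From knot m on, all knots equal s, and each further factor is the shear of a vector to itself,
    the identity. *)
Lemma partial_transport_stable m n r s : 1 <= m%:R * (mesh r / 2) ->
  (m <= n)%N -> partial_transport n r s = partial_transport m r s.
Proof.
move=> hm /subnK <-; elim: (n - m)%N => [|k IHk] //.
have hk l : 1 <= (l + m)%:R * (mesh r / 2).
  apply: le_trans hm _; rewrite ler_wpM2r ?ler_nat ?leq_addl //.
  by rewrite divr_ge0 // ltW ?mesh_gt0.
by rewrite addSn /= IHk -addSn !knot_end // shearxx mul1mx.
Qed.

Lemma cvg_partial_transport n (q : unit_itv R * rope R) :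
  partial_transport n x.2 x.1 @[x --> q] --> partial_transport n q.2 q.1.
Proof.
have c2 : x.2 @[x --> q] --> q.2 by exact: cvg_snd.
elim: n => [|n IHn] /=; first exact: cvg_cst.
apply: cvg_mulmx => //; apply: cvg_shear; first exact: chord_neq0.
  by apply: cvg_chord => //; exact: cvg_knot.
by apply: cvg_chord => //; exact: cvg_knot.
Qed.

(** This integer may jump as r varies; by [transportE] any other sufficient number of steps gives
    the same matrix, so the jumps are harmless. *)
Definition knots r : nat := (Num.trunc (2 / mesh r)).+1.

Lemma knots_ge r n : 2 / mesh r <= n%:R -> 1 <= n%:R * (mesh r / 2).
Proof.
have m0 := mesh_gt0 r.
by rewrite ler_pdivrMr // => ?; lra.
Qed.

Definition transport r s := partial_transport (knots r) r s.

Lemma transportE n r s : 2 / mesh r <= n%:R ->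
  transport r s = partial_transport n r s.
Proof.
move=> hn; have hk : 2 / mesh r <= (knots r)%:R.
  by rewrite ltW // truncnS_gt.
rewrite /transport.
rewrite -(partial_transport_stable (n := maxn n (knots r)) s (knots_ge hk)).
  by apply: partial_transport_stable; [exact: knots_ge|exact: leq_maxl].
exact: leq_maxr.
Qed.

Lemma chord_transport r s : chord r s *m transport r s = pointB.
Proof.
rewrite -(partial_transport_chord (knots r) r s) knot_end //.
by apply: knots_ge; rewrite ltW // truncnS_gt.
Qed.

Lemma transport_continuous :
  continuous (fun x : unit_itv R * rope R => transport x.2 x.1).
Proof.
move=> q; have m0 := mesh_gt0 q.2.
(* Near [q.2] the mesh stays above half its value there, so this one n suffices for all nearby
   ropes, and the transport is locally a product of fixed length. *)
pose n := (Num.trunc (2 / (mesh q.2 / 2))).+1.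
have hn : \forall x \near q, 2 / mesh x.2 <= n%:R.
  have c2 : x.2 @[x --> q] --> q.2 by exact: cvg_snd.
  have : \forall x \near q, mesh q.2 / 2 < mesh x.2.
    apply: (cvgr_gt (mesh q.2) (cvg_comp _ _ c2 (@mesh_continuous q.2))).
    by rewrite ltr_pdivrMr // ltr_pMr // ltr1n.
  apply: filterS => x hx; apply: le_trans (ltW (truncnS_gt _)).
  by rewrite ler_pM2l // lef_pV2 ?posrE ?divr_gt0 ?mesh_gt0 // ltW.
suff : transport x.2 x.1 @[x --> q] --> transport q.2 q.1 by [].
rewrite (transportE (n := n)); last exact: nbhs_singleton hn.
apply: (@cvg_trans _ (partial_transport n x.2 x.1 @[x --> q])); last first.
  exact: cvg_partial_transport.
apply: near_eq_cvg.
by apply: filterS hn => x hx; rewrite (transportE _ hx).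
Qed.

End Mesh.

(** * The contraction of the space of ropes to the segment *)

Section Contraction.
Context {R : realType}.
Implicit Types (r : rope R) (s t : unit_itv R).

Lemma has_velocity_mulmx (f : unit_itv R -> 'rV[R]_3) t v (A : 'M[R]_3) :
  has_velocity f t v -> has_velocity (fun u => f u *m A) t (v *m A).
Proof.
move=> fv; rewrite /has_velocity.
have -> : diff_quotient (fun u => f u *m A) t =
    fun u => diff_quotient f t u *m A.
  by apply/funext => u; rewrite /diff_quotient -scalemxAl mulmxBl.
by apply: cvg_mulmx => //; exact: cvg_cst.
Qed.

Definition shrink_curve r s t := scaled r s t *m transport r s.

Lemma has_velocity_shrink r s t : has_velocity (shrink_curve r s) t
  (rope_velocity r (mul_itv s t) *m transport r s).
Proof. by apply: has_velocity_mulmx; exact: has_velocity_scaled. Qed.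

Lemma shrink_velocity_continuous : continuous
  (fun p : (unit_itv R * rope R) * unit_itv R =>
     rope_velocity p.1.2 (mul_itv p.1.1 p.2) *m transport p.1.2 p.1.1).
Proof.
move=> p; apply: cvg_mulmx; first exact: scaled_velocity_continuous.
have c1 : q.1 @[q --> p] --> p.1 by exact: cvg_fst.
exact: (cvg_comp _ _ c1 (@transport_continuous R p.1)).
Qed.

Lemma shrink_is_rope r s : is_rope (shrink_curve r s).
Proof.
apply: (@is_rope_intro _ _
  (fun t => rope_velocity r (mul_itv s t) *m transport r s))
  => [t|t|t|t u||].
- exact: has_velocity_shrink.
- have ct : (((s, r), u) : (unit_itv R * rope R) * unit_itv R) @[u --> t]
      --> ((s, r), t).
    have c1 : ((s, r) : unit_itv R * rope R) @[u --> t] --> (s, r).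
      exact: (@cvg_cst _ ((s, r) : unit_itv R * rope R) _ (nbhs t) _).
    exact: (cvg_pair c1 cvg_id).
  exact: (cvg_comp _ _ ct (@shrink_velocity_continuous ((s, r), t))).
(* The transport has trivial kernel, so it preserves both non-zero velocities and, in the next case,
   injectivity. *)
- apply/eqP => /partial_transport_inj; apply/eqP.
  by have [_ + _ _ _] := svalP r; exact.
- move=> /eqP; rewrite -subr_eq0 -mulmxBl => /eqP /partial_transport_inj /eqP.
  by rewrite subr_eq0 => /eqP /scaled_inj.
- by rewrite /shrink_curve scaled0 mul0mx.
- exact: chord_transport.
Qed.

Definition shrink r s : rope R := exist _ _ (shrink_is_rope r s).

Lemma shrink_continuous :
  continuous (fun q : unit_itv R * rope R => shrink q.2 q.1).
Proof.
apply: continuous_rope => q e e0.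
have := near_uniform q unit_itv_compact shrink_velocity_continuous e0.
apply: filterS => q' qq' t; rewrite /rope_velocity.
by rewrite !(has_velocityE (@has_velocity_shrink _ _ _)); exact: qq'.
Qed.

Lemma rope_eq r r' : sval r =1 sval r' -> r = r'.
Proof. by move=> /funext; exact: eq_sig_hprop. Qed.

Lemma shrink1 r : shrink r (itv1 R) = r.
Proof.
apply: rope_eq => t /=.
by rewrite /shrink_curve scaled1 /transport partial_transport1 mulmx1.
Qed.

Lemma pointB_neq0 : pointB != 0 :> 'rV[R]_3.
Proof.
by apply/eqP => /rowP /(_ 0) /eqP; rewrite !mxE !eqxx oner_eq0.
Qed.

Lemma segment_is_rope : is_rope (fun t => set_val t *: pointB : 'rV[R]_3).
Proof.
apply: (@is_rope_intro _ _ (fun=> pointB)) => [t||t|t u||].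
- exact: has_velocity_line.
- exact: cst_continuous.
- exact: pointB_neq0.
- move=> /eqP; rewrite -subr_eq0 -scalerBl scaler_eq0 (negPf pointB_neq0) orbF.
  by rewrite subr_eq0 => /eqP /set_val_inj.
- by rewrite set_val0 scale0r.
- by rewrite set_val1 scale1r.
Qed.

Definition segment : rope R := exist _ _ segment_is_rope.

(** At s = 0 the rescaled rope is t r'(0) and its chord is r'(0), which the transport sends to B; by
    linearity the curve becomes tB. *)
Lemma shrink0 r : shrink r (itv0 R) = segment.
Proof.
apply: rope_eq => t /=; rewrite -(chord_transport r (itv0 R)).
rewrite /shrink_curve /chord /scaled set_val0 eqxx set_val1 scale1r.
by rewrite -scalemxAl.
Qed.

End Contraction.

Theorem theorem1p3 (R : realType) : contractible R (rope R).
Proof.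
exists segment.
(* Time is reversed: [shrink] is the identity at parameter 1, whereas the homotopy must be so at
   time 0. *)
exists (fun q => shrink q.2 (clamp (1 - set_val q.1))); split=> [q|r|r].
- have c1 : x.1 @[x --> q] --> q.1 by exact: cvg_fst.
  have c2 : x.2 @[x --> q] --> q.2 by exact: cvg_snd.
  have cc : clamp (1 - set_val x.1) @[x --> q] --> clamp (1 - set_val q.1).
    apply: (@continuous_comp _ _ _
      (fun x : unit_itv R * rope R => 1 - set_val x.1) clamp); last first.
      exact: clamp_continuous.
    apply: cvgB; first exact: cvg_cst.
    exact: (cvg_comp _ _ c1 (@set_val_continuous R q.1)).
  exact: (cvg_comp2 (h := fun s r => shrink r s) cc c2
    (@shrink_continuous R (_, _))).
- by rewrite /= set_val0 subr0 -set_val1 set_valK shrink1.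
- by rewrite /= set_val1 subrr -set_val0 set_valK shrink0.
Qed.
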